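(* Let $\mathcal D=(\mathcal T,\Psi)$ be any Markov Trace Model. The following properties hold. (a) A map $\pi:S(\mathcal T)\to\mathbb R$ is a stationary distribution of $\mathcal D$ if and only if there exists a stationary distribution $\sigma$ of the Kernel $Ker(\mathcal D)$ such that $$\forall \langle T,i\rangle\in S(\mathcal T)\qquad \pi(\langle T,i\rangle)=\frac{1}{\sum_{u\in P(\mathcal T)}\sigma(u)\Lambda_\Psi(u)}\,\sigma(T_{start})\,\psi_{T_{start}}(T).$$ (b) A map $\sigma:P(\mathcal T)\to\mathbb R$ is a stationary distribution of $Ker(\mathcal D)$ if and only if there exists a stationary distribution $\pi$ of $\mathcal D$ such that $$\forall u\in P(\mathcal T)\qquad \sigma(u)=\frac{1}{\sum_{T\in\mathcal T}\pi(\langle T,1\rangle)}\sum_{T\in\mathcal T^{\mathrm{out}}(u)}\pi(\langle T,1\rangle).$$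
   Context: Fix a set of points (a metric space) $X$. A trace is a finite sequence $T=(T(0),\dots,T(|T|-1))$ of at least two points of $X$ (not necessarily distinct); $|T|$ is the number of its points, $T_{start}=T(0)$, $T_{end}=T(|T|-1)$. For a (possibly infinite) set of traces $\mathcal T$: $\mathcal T^{\mathrm{out}}(u)=\{T\in\mathcal T: T_{start}=u\}$, $\mathcal T(u,v)=\{T\in\mathcal T: T_{start}=u,\ T_{end}=v\}$, $P(\mathcal T)=\{u\in X:\mathcal T^{\mathrm{out}}(u)\ne\emptyset\}$, $S(\mathcal T)=\{\langle T,i\rangle: T\in\mathcal T,\ 1\le i\le |T|-1\}$. $\mathcal T$ is endless if for every $T\in\mathcal T$ there is $T'\in\mathcal T$ with $T'_{start}=T_{end}$. A Markov Trace Model (MTM) is a pair $\mathcal D=(\mathcal T,\Psi)$ where $\mathcal T$ is an endless set of traces with $|P(\mathcal T)|<\infty$ and $\Psi=\{\psi_u\}_{u\in P(\mathcal T)}$ is a family with $\psi_u$ a probability distribution over $\mathcal T^{\mathrm{out}}(u)$ for each $u$. It determines a Markov chain $\mathcal M_{\mathcal D}$ with state space $S(\mathcal T)$ and transition probabilities: $\Pr(\langle T,i\rangle\to\langle T,i+1\rangle)=1$ for $1\le i<|T|-1$; $\Pr(\langle T,|T|-1\rangle\to\langle T',1\rangle)=\psi_{T_{end}}(T')$ for $T'\in\mathcal T^{\mathrm{out}}(T_{end})$; all other transition probabilities are $0$. A stationary distribution of $\mathcal D$ is a stationary probability distribution of $\mathcal M_{\mathcal D}$. The Kernel $Ker(\mathcal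 D)$ is the Markov chain with state space $P(\mathcal T)$ and transition probabilities $\Pr(u\to v)=\sum_{T\in\mathcal T(u,v)}\psi_u(T)$ if $\mathcal T(u,v)\neq\emptyset$, and $0$ otherwise. Finally $\Lambda_\Psi(u)=\sum_{T\in\mathcal T^{\mathrm{out}}(u)}(|T|-1)\psi_u(T)$ for $u\in P(\mathcal T)$.
   Formalization: The formal theorem additionally assumes that Λ_Ψ(u) is finite for every u in P(T); with infinite mean trace length (e.g. one point, constant traces, ψ_u of the trace with |T|-1=n equal to c/n²) the claim fails, since D then has no stationary distribution. *)

(* Defs.v *)
From mathcomp Require Import all_boot all_order all_algebra.
From mathcomp Require Import all_classical all_reals all_analysis.

Set Implicit Arguments.
Unset Strict Implicit.
Unset Printing Implicit Defensive.

Import Order.TTheory GRing.Theory Num.Theory.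
Local Open Scope classical_set_scope.
Local Open Scope ring_scope.

(* The trace (T(0), ..., T(n.+1)) is stored as its tag n, so that |T| = n.+2,
   together with the tuple of its points. *)
Notation trace X := {n : nat & n.+2.-tuple X}.

Definition tlen (X : Type) (T : trace X) : nat := (tag T).+2.

Definition tstart (X : Type) (T : trace X) : X := tnth (tagged T) ord0.

Definition tend (X : Type) (T : trace X) : X := tnth (tagged T) ord_max.

Section TraceSets.
Variable X : Type.
Implicit Types (TT : set (trace X)) (u v : X).

Definition tout TT u : set (trace X) := [set T | TT T /\ tstart T = u].

Definition tbetween TT u v : set (trace X) :=
  [set T | [/\ TT T, tstart T = u & tend T = v]].

Definition tpoints TT : set X := [set u | tout TT u !=set0].

Definition tstates TT : set (trace X * nat) :=
  [set s | TT s.1 /\ (1 <= s.2 <= (tlen s.1).-1)%N].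

Definition endless TT : Prop :=
  forall T, TT T -> exists2 T', TT T' & tstart T' = tend T.

End TraceSets.

Section Distributions.
Variables (R : realType) (V : choiceType).

(* Sums over infinite, possibly uncountable, sets of nonnegative terms are
   [esum]. Families indexed by the elements of A are functions on the ambient
   type V; their values outside A are never used. *)
Definition is_distribution (A : set V) (f : V -> R) : Prop :=
  (forall x, A x -> 0 <= f x) /\ (\esum_(x in A) (f x)%:E)%E = 1%E.

Definition is_stationary (A : set V) (p : V -> V -> R) (f : V -> R) : Prop :=
  is_distribution A f /\
  (forall y, A y -> (\esum_(x in A) (f x * p x y)%:E)%E = (f y)%:E).

End Distributions.

Record mtm (R : realType) (X : metricType R) := MTM {
  traces : set (trace X);
  psi : X -> trace X -> R;
  mtm_endless : endless traces;
  mtm_finite : finite_set (tpoints traces);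
  mtm_distribution : forall u, tpoints traces u ->
    is_distribution (tout traces u) (psi u) }.

Section MarkovTraceModel.
Variables (R : realType) (X : metricType R) (D : mtm X).
Implicit Types (s t : trace X * nat) (u v : X).

(* To be read on the states <T, i> with 1 <= i <= |T| - 1. *)
Definition mtm_trans s t : R :=
  if (s.2 < (tlen s.1).-1)%N then (t == (s.1, s.2.+1))%:R
  else if (t.2 == 1)%N && (t.1 \in tout (traces D) (tend s.1))
       then psi D (tend s.1) t.1
       else 0.

Definition mtm_stationary (f : trace X * nat -> R) : Prop :=
  is_stationary (tstates (traces D)) mtm_trans f.

(* The sum is at most 1, hence [fine] loses nothing; it is 0 when there is no
   trace from u to v. *)
Definition kernel_trans u v : R :=
  fine (\esum_(T in tbetween (traces D) u v) (psi D u T)%:E)%E.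

Definition kernel_stationary (sigma : X -> R) : Prop :=
  is_stationary (tpoints (traces D)) kernel_trans sigma.

(* May be +oo, when psi_u has infinite mean trace length. *)
Definition Lambda u : \bar R :=
  (\esum_(T in tout (traces D) u) ((tlen T).-1%:R * psi D u T)%:E)%E.

End MarkovTraceModel.

(* Main.v *)
(* A stationary distribution of the trace chain is constant along each trace,
   and its balance equation at the first state of T reads
   mu(T, 1) = w(T_start) psi(T), where w(u) is the mass of the final states of
   the traces ending at u. So mu is the flow of a nonnegative weight w on the
   points; the balance equations say exactly that w is invariant under the
   kernel, and mu has total mass sum_u w(u) Lambda(u). Both parts follow by
   rescaling w: sigma is w normalized to total mass 1. *)
Require Import Defs.
From mathcomp Require Import all_boot all_order all_algebra.
From mathcomp Require Import all_classical all_reals all_analysis.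

Set Implicit Arguments.
Unset Strict Implicit.
Unset Printing Implicit Defensive.

Import Order.TTheory GRing.Theory Num.Theory.
Local Open Scope classical_set_scope.
Local Open Scope ring_scope.


(** * Sums of nonnegative families: scaling, restriction, grouping *)

Section EsumComplements.
Variables (R : realType) (V W : choiceType).
Local Open Scope ereal_scope.
Implicit Types (A B : set V) (a : V -> \bar R).

Lemma esumZl A a (r : R) : (0 <= r)%R -> (forall x, A x -> 0 <= a x) ->
  \esum_(x in A) (r%:E * a x) = r%:E * \esum_(x in A) a x.
Proof.
(* The supremum ranges over a nonempty set, witnessed by the empty sum, so scaling is safe even for
   [r = 0]. *)
move=> r0 a0; rewrite /esum -ereal_supZl//; last first.
  apply/set0P; exists (\sum_(x \in set0) a x)%E.
  by exists set0 => //; exact: fsets_set0.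
rewrite image_comp; congr ereal_sup; apply: eq_imagel => F /= [finF FA].
rewrite !fsbig_finite//= big_seq [in RHS]big_seq ge0_sume_distrr// => x.
by rewrite in_fset_set// inE => /FA/a0.
Qed.

Lemma esum_restrict A B a : B `<=` A -> (forall x, A x -> ~ B x -> a x = 0) ->
  \esum_(x in A) a x = \esum_(x in B) a x.
Proof.
move=> BA a0; rewrite (esum_mkcond A) (esum_mkcond B); apply: eq_esum => x _.
case: ifPn; rewrite ?inE ?notin_setE => Ax; case: ifPn;
  rewrite ?inE ?notin_setE => Bx //; first exact: a0.
by case: Ax; exact: BA.
Qed.

Lemma esum_fibers A (B : set W) (g : V -> W) a :
  (forall x, A x -> B (g x)) -> (forall x, A x -> 0 <= a x) ->
  \esum_(x in A) a x =
  \esum_(y in B) \esum_(x in [set x | A x /\ g x = y]) a x.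
Proof.
move=> AB a0; rewrite esum_esum; last by move=> y x By [/a0].
(* A pair [(y, x)] with [g x = y] is determined by [x], so the second projection is a bijection onto
   [A]. *)
apply: (reindex_esum _ _ (fun z : W * V => z.2)); split.
- by move=> [y x] /= [_ []].
- move=> [y1 x1] [y2 x2]; rewrite !inE /= => -[_ [_ <-]] [_ [_ <-]].
  by move=> ->.
- by move=> x Ax; exists (g x, x) => //=; split=> //; exact: AB.
Qed.

End EsumComplements.

Lemma esum_const_interval (R : realType) (n : nat) (c : R) : 0 <= c ->
  (\esum_(i in [set i | (1 <= i <= n)%N]) c%:E)%E = (n%:R * c)%:E.
Proof.
move=> c0.
have -> : [set i | (1 <= i <= n)%N] = [set` iota 1 n].
  by apply/seteqP; split=> i /=; rewrite mem_iota add1n ltnS.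
rewrite esum_fset//; last exact: finite_seq.
rewrite -fsbig_seq ?iota_uniq// sumEFin; congr (_%:E).
by rewrite big_const_seq count_predT size_iota iter_addr_0 mulr_natl.
Qed.


(** * Flows of weights on the points *)

Section MTMFlow.
Variables (R : realType) (X : metricType R) (D : mtm X).
Local Notation TT := (traces D).
Local Notation P := (tpoints TT).
Implicit Types (w : X -> R) (mu : trace X * nat -> R).

(** The right-hand side of part (a), with the normalizing factor absorbed into [w]. *)
Definition flow w (T : trace X) : R := w (tstart T) * psi D (tstart T) T.

(** The balance half of stationarity; total mass is left free so that weights can be rescaled. *)
Definition kernel_invariant w : Prop := forall v, P v ->
  (\esum_(u in P) (w u * kernel_trans D u v)%:E)%E = (w v)%:E.

Lemma tstart_point T : TT T -> P (tstart T).
Proof. by move=> TT_T; exists T. Qed.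

Lemma psi_ge0 u T : tout TT u T -> 0 <= psi D u T.
Proof.
move=> uT; have Pu : P u by exists T.
by have [/(_ _ uT)] := mtm_distribution Pu.
Qed.

Lemma esum_psi u : P u -> (\esum_(T in tout TT u) (psi D u T)%:E)%E = 1%E.
Proof. by move=> /(@mtm_distribution _ _ D)[]. Qed.

Lemma flow_ge0 w T : (forall u, P u -> 0 <= w u) -> TT T -> 0 <= flow w T.
Proof.
move=> w0 TT_T; rewrite mulr_ge0 ?w0 ?psi_ge0//; exact: tstart_point.
Qed.

Lemma tlast_state T : TT T -> tstates TT (T, (tlen T).-1).
Proof. by move=> TT_T; split => //=; rewrite leqnn. Qed.

Lemma EFin_kernel_trans u v :
  (\esum_(T in tbetween TT u v) (psi D u T)%:E)%E = (kernel_trans D u v)%:E.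
Proof.
have out_sub T : tbetween TT u v T -> tout TT u T by case.
rewrite fineK// fin_numElt; apply/andP; split.
  by rewrite (lt_le_trans (ltNyr 0))// esum_ge0// => T /out_sub/psi_ge0.
(* If no trace joins [u] to [v], then [u] may lie outside [P], where [psi D u] need not be a
   distribution. *)
have [uv0|/set0P[T0 uvT0]] := eqVneq (tbetween TT u v) set0.
  by rewrite uv0 esum_set0 ltry.
apply: (@le_lt_trans _ _ 1%E); last exact: ltry.
rewrite -(@esum_psi u); last by exists T0; exact: out_sub.
rewrite esum_mkcond [leRHS]esum_mkcond le_esum// => T _.
case: ifPn => [/set_mem/out_sub uT|_]; first by rewrite mem_set.
by case: ifPn => [/set_mem/psi_ge0|].
Qed.

Lemma kernel_trans_ge0 u v : 0 <= kernel_trans D u v.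
Proof. by rewrite fine_ge0// esum_ge0// => T [TT_T Tu _]; exact: psi_ge0. Qed.

Lemma esum_flow_out w u : (forall u, P u -> 0 <= w u) -> P u ->
  (\esum_(T in tout TT u) (flow w T)%:E)%E = (w u)%:E.
Proof.
move=> w0 Pu; rewrite -[RHS]mule1 -(esum_psi Pu) -esumZl ?w0//; last first.
  by move=> T /psi_ge0.
by apply: eq_esum => T [_ Tu]; rewrite /flow Tu EFinM.
Qed.

Lemma esum_flow w : (forall u, P u -> 0 <= w u) ->
  (\esum_(T in TT) (flow w T)%:E)%E = (\esum_(u in P) (w u)%:E)%E.
Proof.
move=> w0; rewrite (@esum_fibers _ _ _ _ P (@tstart X))//.
- by apply: eq_esum => u Pu; rewrite -(esum_flow_out w0 Pu).
- exact: tstart_point.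
- by move=> T TT_T; rewrite lee_fin flow_ge0.
Qed.

(** Grouping the traces that arrive at [v] by their start turns one step of the trace chain into one
    step of the kernel. *)
Lemma esum_flow_in w v : (forall u, P u -> 0 <= w u) ->
  (\esum_(T in [set T | TT T /\ tend T = v]) (flow w T)%:E)%E =
  (\esum_(u in P) (w u * kernel_trans D u v)%:E)%E.
Proof.
move=> w0; rewrite (@esum_fibers _ _ _ _ P (@tstart X)).
- apply: eq_esum => u Pu.
  rewrite EFinM -EFin_kernel_trans -esumZl ?w0//; last first.
    by move=> T [TT_T Tu _]; rewrite lee_fin psi_ge0.
  rewrite [X in esum X _](_ : _ = tbetween TT u v).
    by apply: eq_esum => T [_ Tu _]; rewrite /flow Tu EFinM.
  by apply/seteqP; split=> T /= [] => [[]|].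
- by move=> T [/tstart_point].
- by move=> T [TT_T _]; rewrite lee_fin flow_ge0.
Qed.

(** Every trace has at least one step, and [psi D u] has mass 1. *)
Lemma Lambda_ge1 u : P u -> (1 <= Lambda D u)%E.
Proof.
move=> Pu; rewrite -(esum_psi Pu); apply: le_esum => T uT.
by rewrite lee_fin ler_peMl ?psi_ge0// ler1n.
Qed.

(** The flow takes the same value on all |T| - 1 states of [T]; grouping by start then produces
    [Lambda]. *)
Lemma esum_flow_states w : (forall u, P u -> 0 <= w u) ->
  (\esum_(s in tstates TT) (flow w s.1)%:E)%E =
  (\esum_(u in P) ((w u)%:E * Lambda D u))%E.
Proof.
move=> w0.
pose J (T : trace X) := [set i | (1 <= i <= (tlen T).-1)%N].
rewrite -(@esum_esum _ _ _ TT J (fun T _ => (flow w T)%:E)); last first.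
  by move=> T i TT_T _; rewrite lee_fin flow_ge0.
under eq_esum do rewrite esum_const_interval ?flow_ge0//.
rewrite (@esum_fibers _ _ _ _ P (@tstart X)).
- apply: eq_esum => u Pu; rewrite -esumZl ?w0//; last first.
    by move=> T uT; rewrite lee_fin mulr_ge0 ?psi_ge0.
  by apply: eq_esum => T [_ Tu]; rewrite /flow Tu -EFinM mulrCA.
- exact: tstart_point.
- by move=> T TT_T; rewrite lee_fin mulr_ge0 ?flow_ge0.
Qed.

(** * Balance equations of the trace chain *)

Lemma esum_step_succ mu T i : (forall s, tstates TT s -> 0 <= mu s) ->
  tstates TT (T, i) -> (i < (tlen T).-1)%N ->
  (\esum_(s in tstates TT) (mu s * mtm_trans D s (T, i.+1))%:E)%E =
  (mu (T, i))%:E.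
Proof.
move=> mu0 Ti iT; rewrite (@esum_restrict _ _ _ [set (T, i)]).
- rewrite esum_set1; first by rewrite /mtm_trans iT eqxx mulr1.
  by rewrite /mtm_trans iT eqxx mulr1 lee_fin mu0.
- by move=> _ ->.
- move=> [T' j] /= _ Tj; rewrite /mtm_trans; case: ifPn => _ /=.
    case: eqP => [[TT' ij]|]; last by rewrite mulr0.
    by case: Tj; rewrite TT' ij.
  (* A final state jumps only to an index 1, whereas the target index [i.+1] is at least 2. *)
  by case: Ti => _ /andP[+ _]; case: (i) => //= k; rewrite mulr0.
Qed.

Lemma esum_step_first mu T : (forall s, tstates TT s -> 0 <= mu s) -> TT T ->
  (\esum_(s in tstates TT) (mu s * mtm_trans D s (T, 1%N))%:E)%E =
  ((psi D (tstart T) T)%:E *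
   \esum_(T' in [set T' | TT T' /\ tend T' = tstart T])
      (mu (T', (tlen T').-1))%:E)%E.
Proof.
move=> mu0 TT_T; rewrite -esumZl ?psi_ge0//; last first.
  by move=> T' [TT_T' _]; rewrite lee_fin mu0//; exact: tlast_state.
pose last_state (T' : trace X) := (T', (tlen T').-1).
rewrite (@esum_restrict _ _ _
  (last_state @` [set T' | TT T' /\ tend T' = tstart T])).
- rewrite esum_image; last by move=> T1 T2 _ _ [].
  apply: eq_esum => T' [TT_T' T'T] /=.
  by rewrite /mtm_trans ltnn eqxx T'T mem_set//= -EFinM mulrC.
- by move=> _ [T' [TT_T' _] <-]; exact: tlast_state.
- move=> [T' j] [/= TT_T' /andP[j1 jT']] T'j; rewrite /mtm_trans /=.
  case: ifPn => [_|]; last rewrite -leqNgt => T'j'.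
    (* A step inside a trace reaches index 1 only from index 0, which is not a state. *)
    by case: eqP => [[_ j0]|]; rewrite ?mulr0//; rewrite -j0 in j1.
  case: ifPn => [/set_mem[_ TT']|]; last by rewrite mulr0.
  case: T'j; exists T' => //; rewrite /last_state; congr (_, _).
  by apply/eqP; rewrite eqn_leq T'j'.
Qed.


(** * From invariant weights to stationary distributions and back *)

Lemma esum_points w : (forall u, P u -> 0 <= w u) ->
  (\esum_(u in P) (w u)%:E)%E = (\sum_(u \in P) w u)%:E.
Proof.
move=> w0; rewrite esum_fset ?fsumEFin//; try exact: mtm_finite.
by move=> u /set_mem/w0; rewrite lee_fin.
Qed.

Lemma esum_mean_length w :
  (forall u, P u -> (Lambda D u < +oo)%E) -> (forall u, P u -> 0 <= w u) ->
  (\esum_(u in P) ((w u)%:E * Lambda D u))%E =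
  (\sum_(u \in P) w u * fine (Lambda D u))%:E.
Proof.
move=> finL w0.
have EL u : P u -> Lambda D u = (fine (Lambda D u))%:E.
  move=> Pu; rewrite fineK// ge0_fin_numE ?finL//.
  exact: le_trans (Lambda_ge1 Pu).
rewrite -esum_points; last first.
  move=> u Pu; rewrite mulr_ge0 ?w0// -lee_fin -EL//.
  exact: le_trans (Lambda_ge1 Pu).
by apply: eq_esum => u Pu; rewrite {1}EL// EFinM.
Qed.

Lemma mtm_stationary_flow w mu :
  (forall u, P u -> (Lambda D u < +oo)%E) -> (forall u, P u -> 0 <= w u) ->
  kernel_invariant w -> \sum_(u \in P) w u * fine (Lambda D u) = 1 ->
  (forall s, tstates TT s -> mu s = flow w s.1) -> mtm_stationary D mu.
Proof.
move=> finL w0 invw w1 mu_flow.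
have mu0 s : tstates TT s -> 0 <= mu s.
  by move=> Ss; rewrite mu_flow ?flow_ge0//; case: Ss.
split; first split => //.
  transitivity (\esum_(s in tstates TT) (flow w s.1)%:E)%E.
    by apply: eq_esum => s Ss; rewrite mu_flow.
  by rewrite esum_flow_states// esum_mean_length// w1.
move=> [T [|[|i]]] [] //= TT_T iT.
  rewrite esum_step_first// mu_flow//= /flow mulrC EFinM; congr (_ * _)%E.
  (* Invariance rewrites the weight at the start of [T] as the total flow of the traces ending
     there. *)
  rewrite -invw -?esum_flow_in//; last exact: tstart_point.
  by apply: eq_esum => T' [TT_T' _]; rewrite mu_flow//; exact: tlast_state.
rewrite esum_step_succ//; last by split=> //=; exact: ltnW.
by rewrite !mu_flow//; split=> //=; exact: ltnW.
Qed.

Lemma flow_of_mtm_stationary mu :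
  (forall u, P u -> (Lambda D u < +oo)%E) -> mtm_stationary D mu ->
  exists w, [/\ forall u, P u -> 0 <= w u, kernel_invariant w,
    \sum_(u \in P) w u * fine (Lambda D u) = 1 &
    forall s, tstates TT s -> mu s = flow w s.1].
Proof.
move=> finL [[mu0 mu1] mu_bal].
have mu_const T i : tstates TT (T, i) -> mu (T, i) = mu (T, 1%N).
  elim: i => [|[|i] IHi] [] //= TT_T iT.
  have Ti : tstates TT (T, i.+1) by split => //=; exact: ltnW.
  rewrite -IHi//; apply: EFin_inj; rewrite -(esum_step_succ mu0 Ti)//.
  by rewrite mu_bal.
(* The sum of [mu] over final states is the factor of [psi] in the balance equation at a first
   state. It is kept in [\bar R] until shown finite. *)
pose w_ u := (\esum_(T in [set T | TT T /\ tend T = u])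
  (mu (T, (tlen T).-1))%:E)%E.
have w_0 u : (0 <= w_ u)%E.
  by apply: esum_ge0 => T [TT_T _]; rewrite lee_fin mu0//; exact: tlast_state.
(* Distinct traces have distinct final states, so this is a partial sum of the total mass 1 of
   [mu]. *)
have w_fin u : (w_ u < +oo)%E.
  apply: (@le_lt_trans _ _ 1%E); last exact: ltry.
  rewrite -mu1 /w_.
  rewrite -(@esum_image _ _ _ _ (fun T : trace X => (T, (tlen T).-1))
    (fun s => (mu s)%:E)); last by move=> T1 T2 _ _ [].
  rewrite esum_mkcond [leRHS]esum_mkcond le_esum// => s _.
  case: ifPn => [/set_mem[T [TT_T _] <-]|_].
    by rewrite mem_set//; exact: tlast_state.
  by case: ifPn => [/set_mem/mu0|].
have w_E u : w_ u = (fine (w_ u))%:E by rewrite fineK// ge0_fin_numE.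
pose w u := fine (w_ u).
have w0 u : P u -> 0 <= w u by move=> _; rewrite fine_ge0.
have mu_flow s : tstates TT s -> mu s = flow w s.1.
  case: s => T i [TT_T iT] /=; rewrite mu_const//; apply: EFin_inj.
  rewrite -mu_bal// esum_step_first// -/(w_ _) w_E -EFinM.
  by rewrite mulrC.
exists w; split => //.
(* With [mu] known to be a flow, the definition of [w] at [v] is itself the incoming flow, hence a
   kernel step. *)
- move=> v Pv; rewrite -esum_flow_in// -w_E.
  by apply: eq_esum => T [TT_T _]; rewrite mu_flow//; exact: tlast_state.
- apply: EFin_inj; rewrite -esum_mean_length// -esum_flow_states// -mu1.
  by apply: eq_esum => s Ss; rewrite mu_flow.
Qed.

(** * Rescaling and normalization *)

Lemma kernel_invariantZ w (c : R) : 0 <= c -> (forall u, P u -> 0 <= w u) ->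
  kernel_invariant w -> kernel_invariant (fun u => c * w u).
Proof.
move=> c0 w0 invw v Pv; rewrite EFinM -invw// -esumZl//; last first.
  by move=> u Pu; rewrite lee_fin mulr_ge0 ?w0 ?kernel_trans_ge0.
by apply: eq_esum => u _; rewrite -mulrA EFinM.
Qed.

Lemma mean_lengthZ w (c : R) :
  \sum_(u \in P) c * w u * fine (Lambda D u) =
  c * \sum_(u \in P) w u * fine (Lambda D u).
Proof. by rewrite mulr_fsumr; apply: eq_fsbigr => u _; rewrite mulrA. Qed.

(** A weighted average of numbers at least 1; it makes the denominator in part (a) positive. *)
Lemma mean_length_ge1 w : (forall u, P u -> (Lambda D u < +oo)%E) ->
  is_distribution P w -> 1 <= \sum_(u \in P) w u * fine (Lambda D u).
Proof.
move=> finL [w0 w1]; rewrite -lee_fin -esum_mean_length// -w1.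
apply: le_esum => u Pu; rewrite -[leLHS]mule1.
by apply: lee_wpmul2l; [rewrite lee_fin w0|exact: Lambda_ge1].
Qed.

Lemma kernel_stationary_normalize w :
  (forall u, P u -> 0 <= w u) -> kernel_invariant w ->
  \sum_(u \in P) w u * fine (Lambda D u) = 1 ->
  let Z := \sum_(u \in P) w u in
  0 < Z /\ kernel_stationary D (fun u => Z^-1 * w u).
Proof.
move=> w0 invw w1 Z.
have Z0 : 0 <= Z by rewrite -lee_fin -esum_points// esum_ge0.
have Zpos : 0 < Z.
  rewrite lt_neqAle Z0 andbT; apply/eqP => ZE.
  (* If the total mass vanished, so would every [w u], contradicting mean length 1. *)
  have : \sum_(u \in P) w u * fine (Lambda D u) = 0.
    apply: fsbig1 => u Pu; suff -> : w u = 0 by rewrite mul0r.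
    apply/eqP; rewrite eq_le w0// andbT -lee_fin ZE -esum_points//.
    apply: esum_ge; exists [set u]; last by rewrite fsbig_set1.
    by split => // _ ->.
  by rewrite w1 => /eqP; rewrite oner_eq0.
split => //; split; last first.
  by apply: kernel_invariantZ => //; rewrite invr_ge0.
split; first by move=> u Pu; rewrite mulr_ge0 ?invr_ge0 ?w0.
rewrite esum_points; last by move=> u Pu; rewrite mulr_ge0 ?invr_ge0 ?w0.
by rewrite -mulr_fsumr -/Z mulVf// gt_eqF.
Qed.

Lemma kernel_stationary_ext w w' : (forall u, P u -> w u = w' u) ->
  kernel_stationary D w -> kernel_stationary D w'.
Proof.
move=> ww' [[w0 w1] invw]; split; first split.
- by move=> u Pu; rewrite -ww' ?w0.
- by rewrite -w1; apply: eq_esum => u Pu; rewrite ww'.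
- move=> v Pv; rewrite -ww'// -invw//.
  by apply: eq_esum => u Pu; rewrite ww'.
Qed.

(** Dividing by [L] brings the mean length to 1, which is the total mass of the flow on the
    states. *)
Lemma mtm_stationary_of_kernel w mu :
  (forall u, P u -> (Lambda D u < +oo)%E) -> kernel_stationary D w ->
  let L := \sum_(u \in P) w u * fine (Lambda D u) in
  (forall s, tstates TT s -> mu s = flow (fun u => L^-1 * w u) s.1) ->
  mtm_stationary D mu.
Proof.
move=> finL [w_dist invw] L.
have L0 : 0 < L by rewrite (lt_le_trans ltr01)// mean_length_ge1.
have [w0 _] := w_dist.
apply: mtm_stationary_flow => //.
- by move=> u Pu; rewrite mulr_ge0 ?w0// invr_ge0 ltW.
- by apply: kernel_invariantZ => //; rewrite invr_ge0 ltW.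
- by rewrite mean_lengthZ -/L mulVf// gt_eqF.
Qed.

End MTMFlow.

Theorem theorem1 (R : realType) (X : metricType R) (D : mtm X)
    (Lambda_finite : forall u, tpoints (traces D) u -> (Lambda D u < +oo)%E) :
  (forall mu : trace X * nat -> R,
     mtm_stationary D mu <->
     exists sigma : X -> R,
       kernel_stationary D sigma /\
       (forall (T : trace X) (i : nat), tstates (traces D) (T, i) ->
          mu (T, i) =
            1 / (\sum_(u \in tpoints (traces D)) sigma u * fine (Lambda D u))
            * (sigma (tstart T) * psi D (tstart T) T)))
  /\
  (forall sigma : X -> R,
     kernel_stationary D sigma <->
     exists mu : trace X * nat -> R,
       mtm_stationary D mu /\
       (forall u : X, tpoints (traces D) u ->
          sigma u =
            1 / fine (\esum_(T in traces D) (mu (T, 1%N))%:E)%E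
            * fine (\esum_(T in tout (traces D) u) (mu (T, 1%N))%:E)%E)).
Proof.
set P := tpoints (traces D).
split=> [mu|sigma]; split.
- move=> /(flow_of_mtm_stationary Lambda_finite)[w [w0 invw w1 mu_flow]].
  have [Z0 stat] := kernel_stationary_normalize w0 invw w1.
  exists (fun u => (\sum_(u \in P) w u)^-1 * w u); split=> // T i Ti.
  (* The normalized weight has mean length [Z^-1], where [Z] is the total mass of [w], so the
     prefactor is [Z] and undoes the normalization. *)
  rewrite mu_flow// mean_lengthZ w1 mulr1 invrK mul1r mulrA mulVKf//.
  by rewrite gt_eqF.
- move=> [sigma [stat muE]].
  apply: (mtm_stationary_of_kernel Lambda_finite stat) => -[T i] Ti.
  by rewrite muE// mul1r mulrA.
- move=> stat; have [sigma_dist _] := stat; have [sigma0 sigma1] := sigma_dist.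
  set L := \sum_(u \in P) sigma u * fine (Lambda D u).
  have L0 : 0 < L.
    by rewrite (lt_le_trans ltr01)// mean_length_ge1.
  pose w u := L^-1 * sigma u.
  have w0 u : P u -> 0 <= w u.
    by move=> Pu; rewrite mulr_ge0 ?sigma0// invr_ge0 ltW.
  exists (fun s => flow D w s.1); split.
    exact: (mtm_stationary_of_kernel Lambda_finite stat).
  (* Since [sigma] has mass 1, the first states carry total mass [L^-1], which cancels the factor in
     [w]. *)
  move=> u Pu /=; rewrite esum_flow// esum_flow_out// esum_points//= /w.
  rewrite -mulr_fsumr; move: sigma1; rewrite esum_points// => -[->].
  by rewrite mulr1 mul1r invrK mulVKf// gt_eqF.
- move=> [mu [stat sigmaE]].
  have [w [w0 invw w1 mu_flow]] := flow_of_mtm_stationary Lambda_finite stat.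
  have [Z0 kstat] := kernel_stationary_normalize w0 invw w1.
  apply: kernel_stationary_ext kstat => u Pu.
  have mu1_flow T : traces D T -> (mu (T, 1%N))%:E = (flow D w T)%:E.
    by move=> TT_T; rewrite mu_flow.
  (* On first states [mu] is the flow, so the given ratio is [w u] over the total mass of [w]. *)
  rewrite sigmaE// mul1r (eq_esum mu1_flow) esum_flow// esum_points//=.
  rewrite (@eq_esum _ _ _ _ (fun T => (flow D w T)%:E)) ?esum_flow_out//.
  by move=> T [TT_T _]; exact: mu1_flow.
Qed.
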